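(* Let $H$ be a Hopf algebra, $A$ an algebra, and $\delta : A \to A \otimes H$ a right coaction. Then there exist a Hopf subalgebra $H_\delta \subseteq H$ and a right $H_\delta$-coaction $\delta_{\mathrm{im}} : A \to A \otimes H_\delta$ such that: (1) $\delta = (\mathrm{id}_A \otimes \iota_{H_\delta})\circ \delta_{\mathrm{im}}$, where $\iota_{H_\delta} : H_\delta \hookrightarrow H$ is the inclusion; (2) $(H_\delta,\iota_{H_\delta},\delta_{\mathrm{im}})$ is the initial object in the category of factorizations of $\delta$. Equivalently, $H_\delta$ is the smallest Hopf subalgebra $L \subseteq H$ such that $\delta(A) \subseteq A \otimes L$.
   Context: All vector spaces, algebras and tensor products are over a fixed ground field $k$. Algebras are associative and unital. A Hopf algebra $H$ has coproduct $\Delta$, counit $\varepsilon$ and bijective antipode $S$. A right coaction of $H$ on an algebra $A$ is a linear map $\delta : A\to A\otimes H$ with $(\delta\otimes\mathrm{id}_H)\circ\delta=(\mathrm{id}_A\otimes\Delta)\circ\delta$ and $(\mathrm{id}_A\otimes\varepsilon)\circ\delta=\mathrm{id}_A$. A Hopf subalgebra is a unital subalgebra that is also a subcoalgebra and is stable under the antipode. A factorization of $\delta$ is a triple $(L,\iota_L,\delta_L)$ where $L\subseteq H$ is a Hopf subalgebra with inclusion $\iota_L:L\hookrightarrow H$ and $\delta_L:A\to A\otimes L$ is a right $L$-coaction such that $\delta=(\mathrm{id}_A\otimes\iota_L)\circ\delta_L$. In the category of factorizations of $\delta$, a morphism $(L,\iota_L,\delta_L)\to(L',\iota_{L'},\delta_{L'})$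 is a Hopf algebra morphism $f:L\to L'$ such that $\delta_{L'}=(\mathrm{id}_A\otimes f)\circ\delta_L$ and $\iota_{L'}\circ f=\iota_L$. *)

(* Defs.v *)
From HB Require Import structures.
From mathcomp Require Import all_boot all_order all_algebra.
From mathcomp Require Import boolp classical_sets.
From mathcomp Require Import freeg.

Set Implicit Arguments.
Unset Strict Implicit.
Unset Printing Implicit Defensive.

Import GRing.Theory.
Local Open Scope ring_scope.

Reserved Notation "U ⊗ V" (at level 40, left associativity).
Reserved Notation "u \ox v" (at level 40, left associativity).

(* MathComp's algType requires 1 != 0; this is an associative unital algebra
   without that restriction, so that the zero algebra is included. *)
HB.mixin Record Lmodule_isPzAlgebra (k : fieldType) A
    of GRing.Lmodule k A := {
  pzone : A;
  pzmul : {bilinear A -> A -> A};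
  pzmulA : associative pzmul;
  pzmul1l : left_id pzone pzmul;
  pzmul1r : right_id pzone pzmul
}.

#[short(type="pzAlgType")]
HB.structure Definition PzAlgebra (k : fieldType) :=
  {A of GRing.Lmodule k A & Lmodule_isPzAlgebra k A}.

(* U ⊗ V is the free vector space on U * V modulo the bilinearity relations. *)
Section TensorProduct.
Variables (k : fieldType) (U V : lmodType k).

Local Notation F := {freeg (U * V)%type / k}.
Local Notation gen u v := (<< (u, v) >> : F).

Inductive tensor_rel : F -> Prop :=
| TensorRelDl u u' v : tensor_rel (gen (u + u') v - gen u v - gen u' v)
| TensorRelDr u v v' : tensor_rel (gen u (v + v') - gen u v - gen u v')
| TensorRelZl a u v : tensor_rel (gen (a *: u) v - a *: gen u v)
| TensorRelZr a u v : tensor_rel (gen u (a *: v) - a *: gen u v)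
| TensorRel0 : tensor_rel 0
| TensorRelL a x y : tensor_rel x -> tensor_rel y -> tensor_rel (a *: x + y).

Definition tensor_relb : pred F := fun x => `[< tensor_rel x >].

Lemma tensor_relP x : reflect (tensor_rel x) (x \in tensor_relb).
Proof. exact: asboolP. Qed.

Lemma tensor_relb_closed : submod_closed tensor_relb.
Proof.
split=> [|a x y /tensor_relP hx /tensor_relP hy]; apply/tensor_relP.
  exact: TensorRel0.
exact: TensorRelL.
Qed.

HB.instance Definition _ :=
  GRing.isSubmodClosed.Build k F tensor_relb tensor_relb_closed.

Definition tensor := Quotient.quot (GRing.ZmodClosed.clone F tensor_relb _).
HB.instance Definition _ := GRing.Zmodule.on tensor.

Definition tensor_pi (x : F) : tensor := \pi_(tensor)%qT x.

Lemma tensor_piP x y : tensor_pi x = tensor_pi y <-> tensor_rel (x - y).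
Proof.
rewrite /tensor_pi; split=> [/eqP|h].
  by rewrite -Quotient.idealrBE => /tensor_relP.
by apply/eqP; rewrite -Quotient.idealrBE; apply/tensor_relP.
Qed.

Lemma tensor_piD x y : tensor_pi (x + y) = tensor_pi x + tensor_pi y.
Proof. exact: Quotient.pi_add. Qed.

Lemma tensor_reprK t : tensor_pi (repr t) = t.
Proof. exact: reprK. Qed.

Definition tensor_scale (a : k) (t : tensor) := tensor_pi (a *: repr t).

Lemma tensor_piZ a x : tensor_pi (a *: x) = tensor_scale a (tensor_pi x).
Proof.
apply/tensor_piP; rewrite -scalerBr -[_ *: _]addr0.
apply: TensorRelL TensorRel0; apply/tensor_piP.
by rewrite tensor_reprK.
Qed.

Lemma tensor_scaleA a b t :
  tensor_scale a (tensor_scale b t) = tensor_scale (a * b) t.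
Proof. by rewrite -[t]tensor_reprK -!tensor_piZ scalerA. Qed.

Lemma tensor_scale1 : left_id 1 tensor_scale.
Proof. by move=> t; rewrite -[t]tensor_reprK -!tensor_piZ scale1r. Qed.

Lemma tensor_scaleDr : right_distributive tensor_scale +%R.
Proof.
move=> a s t; rewrite -[s]tensor_reprK -[t]tensor_reprK.
by rewrite -!(tensor_piD, tensor_piZ) scalerDr.
Qed.

Lemma tensor_scaleDl t : {morph tensor_scale^~ t : a b / a + b}.
Proof.
move=> a b /=; rewrite -[t]tensor_reprK.
by rewrite -!(tensor_piD, tensor_piZ) scalerDl.
Qed.

HB.instance Definition _ := GRing.Zmodule_isLmodule.Build k tensor
  tensor_scaleA tensor_scale1 tensor_scaleDr tensor_scaleDl.

Lemma tensor_pi_linear : linear tensor_pi.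
Proof. by move=> a x y; rewrite tensor_piD tensor_piZ. Qed.

HB.instance Definition _ :=
  GRing.isLinear.Build k F tensor *:%R tensor_pi tensor_pi_linear.

Definition tens (u : U) (v : V) : tensor := tensor_pi (gen u v).

Lemma tens_bilinear : bilinear_for *:%R *:%R tens.
Proof.
have aux (p q r s : F) : p - (q + r) = p - s - r + (s - q).
  by rewrite opprD addrA [p - s - r]addrAC addrA addrNK addrAC.
split=> w a x y /=; rewrite /tens -linearZ -tensor_piD;
  apply/tensor_piP.
- have -> : gen (a *: x + y) w - (a *: gen x w + gen y w) =
    1 *: (gen (a *: x + y) w - gen (a *: x) w - gen y w) +
    (1 *: (gen (a *: x) w - a *: gen x w) + 0).
    by rewrite !scale1r addr0 -aux.
  exact: TensorRelL (TensorRelDl _ _ _)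
    (TensorRelL 1 (TensorRelZl _ _ _) TensorRel0).
- have -> : gen w (a *: x + y) - (a *: gen w x + gen w y) =
    1 *: (gen w (a *: x + y) - gen w (a *: x) - gen w y) +
    (1 *: (gen w (a *: x) - a *: gen w x) + 0).
    by rewrite !scale1r addr0 -aux.
  exact: TensorRelL (TensorRelDr _ _ _)
    (TensorRelL 1 (TensorRelZr _ _ _) TensorRel0).
Qed.

HB.instance Definition _ :=
  bilinear_isBilinear.Build k U V tensor *:%R *:%R tens tens_bilinear.

End TensorProduct.

Notation "U ⊗ V" := (tensor U V).
Notation "u \ox v" := (tens u v) : ring_scope.

Section FreeLift.
Variables (k : fieldType) (K : choiceType) (W : lmodType k) (f : K -> W).

HB.instance Definition _ := GRing.isZmodMorphism.Build {freeg K / k} W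
  (fglift f) (lift_is_additive f).

Lemma fgliftE x : fglift f x = \sum_(z <- dom x) coeff z x *: f z.
Proof.
rewrite -[in LHS](freeg_sumE x) raddf_sum; apply: eq_bigr => z _.
exact: liftU.
Qed.

Lemma fglift_scalable : scalable (fglift f : {freeg K / k} -> W).
Proof.
move=> a x; rewrite [in RHS]fgliftE scaler_sumr.
have -> : a *: x = \sum_(z <- dom x) << a * coeff z x *g z >> by [].
rewrite raddf_sum; apply: eq_bigr => z _ /=.
by rewrite liftU scalerA.
Qed.

HB.instance Definition _ := GRing.isScalable.Build k {freeg K / k} W *:%R
  (fglift f) fglift_scalable.

End FreeLift.

Section UniversalProperty.
Variables (k : fieldType) (U V W : lmodType k).

Lemma tens_sum (t : U ⊗ V) :
  exists s : seq (U * V), t = \sum_(p <- s) p.1 \ox p.2.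
Proof.
rewrite -[t]tensor_reprK -[repr t]freeg_sumE linear_sum.
set D := repr t.
exists [seq (coeff z D *: z.1, z.2) | z <- dom D]; rewrite [RHS]big_map.
apply: eq_bigr => -[u v] _ /=; rewrite linearZl_LR /= /tens -linearZ /=.
congr tensor_pi; apply/eqP/freeg_eqP=> z.
by rewrite coeffZ !coeffU mul1r.
Qed.

Lemma tens_ext (f g : {linear U ⊗ V -> W}) :
  (forall u v, f (u \ox v) = g (u \ox v)) -> f =1 g.
Proof.
move=> fg t; have [s ->] := tens_sum t.
by rewrite !linear_sum; apply: eq_bigr => p _ /=.
Qed.

Variable f : {bilinear U -> V -> W}.

Definition tlift (t : U ⊗ V) : W := fglift (fun p => f p.1 p.2) (repr t).

Lemma tlift_rel x : tensor_rel x -> fglift (fun p : U * V => f p.1 p.2) x = 0.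
Proof.
elim=> [u u' v|u v v'|a u v|a u v||a y z _ hy _ hz];
  rewrite ?(linearB, linearD, linearZ) /= ?liftU ?scale1r /=.
- by rewrite linearDl /= addrAC addrK subrr.
- by rewrite linearD /= addrAC addrK subrr.
- by rewrite linearZl_LR scalerN subrr.
- by rewrite linearZr /= scalerN subrr.
- by rewrite linear0.
- by rewrite hy hz scaler0 addr0.
Qed.

Lemma tlift_pi x : tlift (tensor_pi x) = fglift (fun p => f p.1 p.2) x.
Proof.
apply/eqP; rewrite -subr_eq0 /tlift -linearB /=; apply/eqP/tlift_rel.
by apply/tensor_piP; rewrite tensor_reprK.
Qed.

Lemma tlift_linear : linear tlift.
Proof.
move=> a s t; rewrite -[s]tensor_reprK -[t]tensor_reprK -linearP !tlift_pi.
exact: linearP.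
Qed.

HB.instance Definition _ :=
  GRing.isLinear.Build k (U ⊗ V) W *:%R tlift tlift_linear.

Lemma tlift_tens u v : tlift (u \ox v) = f u v.
Proof. by rewrite tlift_pi liftU scale1r. Qed.

Lemma tlift_sum (s : seq (U * V)) :
  tlift (\sum_(p <- s) p.1 \ox p.2) = \sum_(p <- s) f p.1 p.2.
Proof. by rewrite linear_sum; apply: eq_bigr => p _; exact: tlift_tens. Qed.

End UniversalProperty.

Section TensLinear.
Variables (k : fieldType) (U V : lmodType k).
Implicit Types (a : k) (u : U) (v : V).

Lemma tensPl a u u' v : (a *: u + u') \ox v = a *: (u \ox v) + u' \ox v.
Proof. exact: (tens_bilinear U V).1. Qed.

Lemma tensPr a u v v' : u \ox (a *: v + v') = a *: (u \ox v) + u \ox v'.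
Proof. exact: (tens_bilinear U V).2. Qed.

Lemma tens_suml I (r : seq I) (E : I -> U) v :
  (\sum_(i <- r) E i) \ox v = \sum_(i <- r) E i \ox v.
Proof. exact: linear_sumlz. Qed.

End TensLinear.

Lemma tens_ext3 (k : fieldType) (U V W X : lmodType k)
    (f g : {linear U ⊗ V ⊗ W -> X}) :
  (forall u v w, f (u \ox v \ox w) = g (u \ox v \ox w)) -> f =1 g.
Proof.
move=> fg; apply: tens_ext => t w; have [s ->] := tens_sum t.
rewrite tens_suml !linear_sum; apply: eq_bigr => p _; exact: fg.
Qed.

Section TensorMap.
Variables (k : fieldType) (U U' V V' : lmodType k).
Variables (f : {linear U -> U'}) (g : {linear V -> V'}).

Definition tmap_fun (u : U) (v : V) : U' ⊗ V' := f u \ox g v.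

Lemma tmap_fun_bilinear : bilinear_for *:%R *:%R tmap_fun.
Proof.
by split=> w a x y; rewrite /tmap_fun linearP ?tensPl ?tensPr.
Qed.

HB.instance Definition _ := bilinear_isBilinear.Build k U V (U' ⊗ V')
  *:%R *:%R tmap_fun tmap_fun_bilinear.

Definition tmap : {linear U ⊗ V -> U' ⊗ V'} := tlift tmap_fun.

Lemma tmapE u v : tmap (u \ox v) = f u \ox g v.
Proof. exact: tlift_tens. Qed.

End TensorMap.

Section Associator.
Variables (k : fieldType) (U V W : lmodType k).

Definition tassoc_fun2 (w : W) (u : U) (v : V) : U ⊗ (V ⊗ W) :=
  u \ox (v \ox w).

Lemma tassoc_fun2_bilinear w : bilinear_for *:%R *:%R (tassoc_fun2 w).
Proof.
by split=> z a x y; rewrite /tassoc_fun2 ?tensPl ?tensPr.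
Qed.

HB.instance Definition _ w := bilinear_isBilinear.Build k U V (U ⊗ (V ⊗ W))
  *:%R *:%R (tassoc_fun2 w) (tassoc_fun2_bilinear w).

Definition tassoc_fun (t : U ⊗ V) (w : W) : U ⊗ (V ⊗ W) :=
  tlift (tassoc_fun2 w) t.

Lemma tassoc_fun_bilinear : bilinear_for *:%R *:%R tassoc_fun.
Proof.
split=> [w|t] a x y; rewrite /tassoc_fun ?linearP //.
have [s ->] := tens_sum t; rewrite !tlift_sum /= scaler_sumr -big_split.
apply: eq_bigr => p _; rewrite /= /tassoc_fun2.
by rewrite !tensPr.
Qed.

HB.instance Definition _ := bilinear_isBilinear.Build k (U ⊗ V) W
  (U ⊗ (V ⊗ W)) *:%R *:%R tassoc_fun tassoc_fun_bilinear.

Definition tassoc : {linear U ⊗ V ⊗ W -> U ⊗ (V ⊗ W)} := tlift tassoc_fun.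

Lemma tassocE u v w : tassoc (u \ox v \ox w) = u \ox (v \ox w).
Proof. rewrite [LHS]tlift_tens; exact: tlift_tens. Qed.

End Associator.
Arguments tassoc {k U V W}.

Section Unitors.
Variables (k : fieldType) (U : lmodType k).

Definition tunitr_fun (u : U) (a : k^o) : U := a *: u.
Definition tunitl_fun (a : k^o) (u : U) : U := a *: u.

Lemma tunitr_fun_bilinear : bilinear_for *:%R *:%R tunitr_fun.
Proof.
split=> w a x y; rewrite /tunitr_fun /=; last by rewrite scalerDl scalerA.
by rewrite scalerDr !scalerA mulrC.
Qed.

Lemma tunitl_fun_bilinear : bilinear_for *:%R *:%R tunitl_fun.
Proof.
split=> w a x y; rewrite /tunitl_fun /=; first by rewrite scalerDl scalerA.
by rewrite scalerDr !scalerA mulrC.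
Qed.

HB.instance Definition _ := bilinear_isBilinear.Build k U k^o U
  *:%R *:%R tunitr_fun tunitr_fun_bilinear.
HB.instance Definition _ := bilinear_isBilinear.Build k k^o U U
  *:%R *:%R tunitl_fun tunitl_fun_bilinear.

Definition tunitr : {linear U ⊗ k^o -> U} := tlift tunitr_fun.
Definition tunitl : {linear k^o ⊗ U -> U} := tlift tunitl_fun.

Lemma tunitrE u a : tunitr (u \ox a) = a *: u.
Proof. exact: tlift_tens. Qed.

Lemma tunitlE a u : tunitl (a \ox u) = a *: u.
Proof. exact: tlift_tens. Qed.

End Unitors.
Arguments tunitr {k U}.
Arguments tunitl {k U}.

Section TensorAlgebra.
Variables (k : fieldType) (A : algType k).

Definition mult_fun (x y : A) : A := x * y.

Lemma mult_fun_bilinear : bilinear_for *:%R *:%R mult_fun.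
Proof.
split=> w a x y; rewrite /mult_fun /=; first by rewrite mulrDl scalerAl.
by rewrite mulrDr scalerAr.
Qed.

HB.instance Definition _ := bilinear_isBilinear.Build k A A A
  *:%R *:%R mult_fun mult_fun_bilinear.

Definition mult : {linear A ⊗ A -> A} := tlift mult_fun.

Lemma multE x y : mult (x \ox y) = x * y.
Proof. exact: tlift_tens. Qed.

Definition tmul_fun2 (x y z w : A) : A ⊗ A := (x * z) \ox (y * w).

Lemma tmul_fun2_bilinear x y : bilinear_for *:%R *:%R (tmul_fun2 x y).
Proof.
split=> w a s t; rewrite /tmul_fun2 mulrDr -scalerAr.
  by rewrite tensPl.
by rewrite tensPr.
Qed.

HB.instance Definition _ x y := bilinear_isBilinear.Build k A A (A ⊗ A)
  *:%R *:%R (tmul_fun2 x y) (tmul_fun2_bilinear x y).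

Definition tmul_fun (t : A ⊗ A) (x y : A) : A ⊗ A := tlift (tmul_fun2 x y) t.

Lemma tmul_fun_bilinear t : bilinear_for *:%R *:%R (tmul_fun t).
Proof.
split=> w a x y; rewrite /tmul_fun; have [s ->] := tens_sum t;
  rewrite !tlift_sum /= scaler_sumr -big_split; apply: eq_bigr => p _;
  rewrite /tmul_fun2 mulrDl -scalerAl.
  by rewrite tensPl.
by rewrite tensPr.
Qed.

HB.instance Definition _ t := bilinear_isBilinear.Build k A A (A ⊗ A)
  *:%R *:%R (tmul_fun t) (tmul_fun_bilinear t).

Definition tmul (s t : A ⊗ A) : A ⊗ A := tlift (tmul_fun t) s.

Lemma tmulE x y z w : tmul (x \ox y) (z \ox w) = (x * z) \ox (y * w).
Proof. rewrite [LHS]tlift_tens; exact: tlift_tens. Qed.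

Lemma tmul_bilinear : bilinear_for *:%R *:%R tmul.
Proof.
split=> [t|s] a x y; rewrite /tmul ?linearP //.
have [r ->] := tens_sum s; rewrite !tlift_sum /= scaler_sumr -big_split.
by apply: eq_bigr => p _; rewrite /= /tmul_fun linearP.
Qed.

HB.instance Definition _ := bilinear_isBilinear.Build k (A ⊗ A) (A ⊗ A)
  (A ⊗ A) *:%R *:%R tmul tmul_bilinear.

End TensorAlgebra.
Arguments mult {k A}.

(* algType loses no generality here, since counit 1 = 1 forces 1 != 0.
   Bijectivity of the antipode is not part of the structure: a Hopf subalgebra
   (see hopfSub) is only required to satisfy S(L) ⊆ L. *)
HB.mixin Record Algebra_isHopf (k : fieldType) H of GRing.Algebra k H := {
  comul : {linear H -> H ⊗ H};
  counit : {linear H -> k^o};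
  antipode : {linear H -> H};
  comulA : forall x : H,
    tassoc (tmap comul idfun (comul x)) = tmap idfun comul (comul x);
  comul_counitl : forall x : H, tunitl (tmap counit idfun (comul x)) = x;
  comul_counitr : forall x : H, tunitr (tmap idfun counit (comul x)) = x;
  comul1 : comul 1 = 1 \ox 1;
  comulM : forall x y : H, comul (x * y) = tmul (comul x) (comul y);
  counit1 : counit 1 = 1;
  counitM : forall x y : H, counit (x * y) = counit x * counit y;
  antipodel : forall x : H,
    mult (tmap antipode idfun (comul x)) = counit x *: 1;
  antipoder : forall x : H,
    mult (tmap idfun antipode (comul x)) = counit x *: 1
}.

#[short(type="hopfAlgType")]
HB.structure Definition HopfAlgebra (k : fieldType) :=
  {H of GRing.Algebra k H & Algebra_isHopf k H}.

(* Over a field injective linear maps split, hence f ⊗ g is injective as soon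
   as f and g are. *)
Section LinearRetraction.
Local Open Scope classical_set_scope.
Variables (k : fieldType) (U V : lmodType k) (f : {linear U -> V}).
Hypothesis f_inj : injective f.

Let P (W : set V) :=
  (forall a x y, W x -> W y -> W (a *: x + y)) /\
  (forall u, W (f u) -> u = 0).

Let complement : exists W : set V, P W /\
  forall x, exists u w, (W w \/ w = 0) /\ x = f u + w.
Proof.
have [F FP Ftot|W [[Wlin Wf] Wmax]] := @Zorn_bigcup V P.
  split=> [a x y [A FA Ax] [B FB By]|u [A FA Au]]; last exact: (FP _ FA).2 Au.
  have [AB|BA] := Ftot _ _ FA FB.
    by exists B => //; apply: (FP _ FB).1 => //; exact: AB.
  by exists A => //; apply: (FP _ FA).1 => //; exact: BA.
exists W; split=> // x; apply: contrapT => nx.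
pose W' : set V := [set y | exists a w, (W w \/ w = 0) /\ y = a *: x + w].
have W0 w : W w -> W 0 by move=> Ww; rewrite -(addNr w) -scaleN1r; exact: Wlin.
have W0D a w w' : W w \/ w = 0 -> W w' \/ w' = 0 ->
    W (a *: w + w') \/ a *: w + w' = 0.
  move=> [Ww|->] [Ww'|->]; rewrite ?scaler0 ?add0r; auto.
  by left; apply: (Wlin) => //; exact: W0 Ww.
apply: (Wmax W').
  split=> [w Ww|W'W]; first by exists 0, w; rewrite scale0r add0r; auto.
  apply: nx; exists 0, x; rewrite linear0 add0r; split=> //; left.
  by apply: W'W; exists 1, 0; rewrite scale1r addr0; auto.
split=> [a _ _ [b [w [Ww ->]]] [c [w' [Ww' ->]]]|u [a [w [Ww fu]]]].
  exists (a * b + c), (a *: w + w'); split; first exact: W0D.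
  by rewrite scalerDr scalerA scalerDl addrACA.
have [a0|a_neq0] := eqVneq a 0.
  case: Ww fu => [Ww|->]; rewrite a0 scale0r add0r => fu.
    by apply: Wf; rewrite fu.
  by apply: f_inj; rewrite fu linear0.
case: nx; exists (a^-1 *: u), ((- a^-1) *: w + 0); split.
  by apply: W0D => //; right.
by rewrite linearZ /= fu scalerDr scalerA mulVf // scale1r addr0 scaleNr addrK.
Qed.

Lemma linear_retraction : exists g : {linear V -> U}, cancel f g.
Proof.
have [W [[Wlin Wf] Wsum]] := complement.
have W0 w : W w -> W 0 by move=> Ww; rewrite -(addNr w) -scaleN1r; exact: Wlin.
have W0D a w w' : W w \/ w = 0 -> W w' \/ w' = 0 ->
    W (a *: w + w') \/ a *: w + w' = 0.
  move=> [Ww|->] [Ww'|->]; rewrite ?scaler0 ?add0r; auto.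
  by left; apply: (Wlin) => //; exact: W0 Ww.
have uniq u u' w w' : W w \/ w = 0 -> W w' \/ w' = 0 ->
    f u + w = f u' + w' -> u = u'.
  move=> Ww Ww' e; apply/eqP; rewrite -subr_eq0; apply/eqP.
  have : f (u - u') = (-1) *: w + w'.
    rewrite linearB scaleN1r /= [RHS]addrC; apply/eqP.
    by rewrite subr_eq addrAC -subr_eq opprK [w' + _]addrC e.
  case: (W0D (-1) w w' Ww Ww') => [h fe|-> fe]; first by apply: Wf; rewrite fe.
  by apply: f_inj; rewrite fe linear0.
pose g x := sval (cid (Wsum x)).
have gP x : exists w, (W w \/ w = 0) /\ x = f (g x) + w.
  by rewrite /g; case: cid.
have glin : linear g.
  move=> a x y; have [w [Ww ex]] := gP x; have [w' [Ww' ey]] := gP y.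
  have [w'' [Ww'' e]] := gP (a *: x + y).
  apply: (uniq _ _ w'' (a *: w + w')) => //; first exact: W0D.
  rewrite -e {1}ex {1}ey linearP /= scalerDr -!addrA; congr (_ + _).
  by rewrite addrCA.
pose gM := GRing.isLinear.Build k V U *:%R g glin.
pose gL : {linear V -> U} := HB.pack g gM.
exists gL => u; have [w [Ww e]] := gP (f u).
by apply: (uniq _ _ w 0); rewrite ?addr0; auto.
Qed.

End LinearRetraction.

Lemma tmap_comp (k : fieldType) (U U' U'' V V' V'' : lmodType k)
    (f : {linear U -> U'}) (f' : {linear U' -> U''})
    (g : {linear V -> V'}) (g' : {linear V' -> V''}) t :
  tmap f' g' (tmap f g t) = tmap (f' \o f) (g' \o g) t.
Proof.
pose lhs : {linear _ -> _} := tmap f' g' \o tmap f g.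
apply: (tens_ext (f := lhs)) => u v.
by rewrite /lhs /= !tmapE.
Qed.

Lemma tmap_id (k : fieldType) (U V : lmodType k)
    (f : {linear U -> U}) (g : {linear V -> V}) :
  f =1 id -> g =1 id -> tmap f g =1 id.
Proof.
by move=> f1 g1; apply: (tens_ext (g := idfun)) => u v; rewrite tmapE f1 g1.
Qed.

Lemma tmap_eq (k : fieldType) (U U' V V' : lmodType k)
    (f f' : {linear U -> U'}) (g g' : {linear V -> V'}) :
  f =1 f' -> g =1 g' -> tmap f g =1 tmap f' g'.
Proof. by move=> ff gg; apply: tens_ext => u v; rewrite !tmapE ff gg. Qed.

Lemma tmap_inj (k : fieldType) (U U' V V' : lmodType k)
    (f : {linear U -> U'}) (g : {linear V -> V'}) :
  injective f -> injective g -> injective (tmap f g).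
Proof.
move=> /linear_retraction[f' fK] /linear_retraction[g' gK].
by apply: (can_inj (g := tmap f' g')) => t; rewrite tmap_comp tmap_id.
Qed.

(* The image of P ⊗ Q in U ⊗ V, for subspaces P of U and Q of V. *)
Definition tens_img (k : fieldType) (U V : lmodType k)
    (P : {pred U}) (Q : {pred V}) (t : U ⊗ V) : Prop :=
  exists2 s : seq (U * V),
    {in s, forall p, p.1 \in P /\ p.2 \in Q} & t = \sum_(p <- s) p.1 \ox p.2.

Record hopfSub (k : fieldType) (H : hopfAlgType k) := HopfSub {
  hsub_pred : {pred H};
  hsub_alg : subalg_closed hsub_pred;
  hsub_coalg : forall x, x \in hsub_pred ->
    tens_img hsub_pred hsub_pred (comul x);
  hsub_antipode : forall x, x \in hsub_pred -> antipode x \in hsub_pred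
}.

Section HopfSubAlgebra.
Variables (k : fieldType) (H : hopfAlgType k) (L : hopfSub H).

Record hsub_sort := HSubElt { hsub_val : H; _ : hsub_val \in hsub_pred L }.

HB.instance Definition _ := GRing.isSubalgClosed.Build k H (hsub_pred L)
  (GRing.subalg_closed_semi (hsub_alg L)).
HB.instance Definition _ := [isSub for hsub_val].
HB.instance Definition _ := [Choice of hsub_sort by <:].
HB.instance Definition _ := [SubChoice_isSubAlgebra of hsub_sort by <:].

Lemma hsub_val_linear : linear hsub_val.
Proof. by []. Qed.

Lemma hsub_val_monoid_morphism : monoid_morphism hsub_val.
Proof. by []. Qed.

HB.instance Definition _ := GRing.isLinear.Build k hsub_sort H *:%R
  hsub_val hsub_val_linear.
HB.instance Definition _ := GRing.isMonoidMorphism.Build hsub_sort H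
  hsub_val hsub_val_monoid_morphism.

Lemma hsub_val_inj : injective hsub_val.
Proof. exact: val_inj. Qed.

Let i2 : {linear hsub_sort ⊗ hsub_sort -> H ⊗ H} := tmap hsub_val hsub_val.

Let i2_inj : injective i2.
Proof. exact: tmap_inj hsub_val_inj hsub_val_inj. Qed.

Lemma hsub_comul_subproof (x : hsub_sort) :
  exists t, tmap hsub_val hsub_val t = comul (hsub_val x).
Proof.
have [s sL ->] := hsub_coalg (valP x).
exists (\sum_(p <- s) insubd (0 : hsub_sort) p.1 \ox insubd 0 p.2).
rewrite linear_sum; apply: eq_big_seq => p /sL[p1 p2] /=.
by rewrite tmapE; congr (_ \ox _); exact: insubdK.
Qed.

(* The coproduct of L is the restriction of that of H; it is well defined
   since L ⊗ L -> H ⊗ H is injective. *)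
Definition hsub_comul (x : hsub_sort) : hsub_sort ⊗ hsub_sort :=
  sval (cid (hsub_comul_subproof x)).

Lemma hsub_comulE x : i2 (hsub_comul x) = comul (hsub_val x).
Proof. by rewrite /hsub_comul; case: cid. Qed.

Lemma hsub_comul_linear : linear hsub_comul.
Proof.
move=> a x y; apply: i2_inj.
by rewrite linearP !hsub_comulE hsub_val_linear linearP.
Qed.

HB.instance Definition _ := GRing.isLinear.Build k hsub_sort
  (hsub_sort ⊗ hsub_sort) *:%R hsub_comul hsub_comul_linear.

Definition hsub_counit : {linear hsub_sort -> k^o} := counit \o hsub_val.

Definition hsub_antipode_fun (x : hsub_sort) : hsub_sort :=
  HSubElt (hsub_antipode (valP x)).

Lemma hsub_antipode_linear : linear hsub_antipode_fun.
Proof. by move=> a x y; apply: hsub_val_inj; rewrite /= !linearP. Qed.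

HB.instance Definition _ := GRing.isLinear.Build k hsub_sort hsub_sort
  *:%R hsub_antipode_fun hsub_antipode_linear.

Let i3 : {linear hsub_sort ⊗ (hsub_sort ⊗ hsub_sort) -> H ⊗ (H ⊗ H)} :=
  tmap hsub_val i2.

Let i3_inj : injective i3.
Proof. exact: tmap_inj hsub_val_inj i2_inj. Qed.

Lemma hsub_comulA (x : hsub_sort) :
  tassoc (tmap hsub_comul idfun (hsub_comul x)) =
  tmap idfun hsub_comul (hsub_comul x).
Proof.
apply: i3_inj.
have -> : i3 (tassoc (tmap hsub_comul idfun (hsub_comul x))) =
    tassoc (tmap i2 hsub_val (tmap hsub_comul idfun (hsub_comul x))).
  pose lhs : {linear _ -> _} := i3 \o tassoc.
  pose rhs : {linear _ -> _} := tassoc \o tmap i2 hsub_val.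
  apply: (tens_ext3 (f := lhs) (g := rhs)) => u v w.
  by rewrite /lhs /rhs /i3 /i2 /= !(tmapE, tassocE).
rewrite /i3 !tmap_comp.
have -> : tmap (i2 \o hsub_comul) (hsub_val \o idfun) (hsub_comul x) =
    tmap comul idfun (i2 (hsub_comul x)).
  by rewrite tmap_comp; apply: tmap_eq => // y; exact: hsub_comulE.
rewrite hsub_comulE comulA -hsub_comulE /i2 tmap_comp.
by apply: tmap_eq => // y; rewrite /= hsub_comulE.
Qed.

Lemma hsub_counitl (x : hsub_sort) :
  tunitl (tmap hsub_counit idfun (hsub_comul x)) = x.
Proof.
apply: hsub_val_inj; rewrite -[RHS]comul_counitl -hsub_comulE.
pose lhs : {linear _ -> _} :=
  [the {linear _ -> _} of hsub_val] \o (tunitl \o tmap hsub_counit idfun).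
pose rhs : {linear _ -> _} := tunitl \o (tmap counit idfun \o i2).
apply: (tens_ext (f := lhs) (g := rhs)) => u v.
by rewrite /lhs /rhs /= /i2 !tmapE !tunitlE linearZ.
Qed.

Lemma hsub_counitr (x : hsub_sort) :
  tunitr (tmap idfun hsub_counit (hsub_comul x)) = x.
Proof.
apply: hsub_val_inj; rewrite -[RHS]comul_counitr -hsub_comulE.
pose lhs : {linear _ -> _} :=
  [the {linear _ -> _} of hsub_val] \o (tunitr \o tmap idfun hsub_counit).
pose rhs : {linear _ -> _} := tunitr \o (tmap idfun counit \o i2).
apply: (tens_ext (f := lhs) (g := rhs)) => u v.
by rewrite /lhs /rhs /= /i2 !tmapE !tunitrE linearZ.
Qed.

Lemma hsub_comul1 : hsub_comul 1 = 1 \ox 1.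
Proof.
by apply: i2_inj; rewrite hsub_comulE /i2 tmapE rmorph1 comul1.
Qed.

Lemma hsub_tmul (s t : hsub_sort ⊗ hsub_sort) :
  i2 (tmul s t) = tmul (i2 s) (i2 t).
Proof.
have [p ->] := tens_sum s; have [q ->] := tens_sum t.
rewrite linear_sumlz !linear_sum linear_sumlz; apply: eq_bigr => u _.
rewrite !linear_sumr linear_sum; apply: eq_bigr => v _.
by rewrite /= tmulE /i2 !tmapE tmulE !rmorphM.
Qed.

Lemma hsub_comulM (x y : hsub_sort) :
  hsub_comul (x * y) = tmul (hsub_comul x) (hsub_comul y).
Proof.
by apply: i2_inj; rewrite hsub_tmul !hsub_comulE rmorphM comulM.
Qed.

Lemma hsub_counit1 : hsub_counit 1 = 1.
Proof. exact: counit1. Qed.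

Lemma hsub_counitM (x y : hsub_sort) :
  hsub_counit (x * y) = hsub_counit x * hsub_counit y.
Proof. exact: counitM. Qed.

Lemma hsub_antipodel (x : hsub_sort) :
  mult (tmap hsub_antipode_fun idfun (hsub_comul x)) = hsub_counit x *: 1.
Proof.
apply: hsub_val_inj; rewrite linearZ rmorph1 /= -antipodel -hsub_comulE.
pose lhs : {linear _ -> _} :=
  [the {linear _ -> _} of hsub_val] \o (mult \o tmap hsub_antipode_fun idfun).
pose rhs : {linear _ -> _} := mult \o (tmap antipode idfun \o i2).
apply: (tens_ext (f := lhs) (g := rhs)) => u v.
by rewrite /lhs /rhs /= /i2 !tmapE !multE rmorphM.
Qed.

Lemma hsub_antipoder (x : hsub_sort) :
  mult (tmap idfun hsub_antipode_fun (hsub_comul x)) = hsub_counit x *: 1.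
Proof.
apply: hsub_val_inj; rewrite linearZ rmorph1 /= -antipoder -hsub_comulE.
pose lhs : {linear _ -> _} :=
  [the {linear _ -> _} of hsub_val] \o (mult \o tmap idfun hsub_antipode_fun).
pose rhs : {linear _ -> _} := mult \o (tmap idfun antipode \o i2).
apply: (tens_ext (f := lhs) (g := rhs)) => u v.
by rewrite /lhs /rhs /= /i2 !tmapE !multE rmorphM.
Qed.

HB.instance Definition _ := Algebra_isHopf.Build k hsub_sort
  hsub_comulA hsub_counitl hsub_counitr hsub_comul1 hsub_comulM
  hsub_counit1 hsub_counitM hsub_antipodel hsub_antipoder.

End HopfSubAlgebra.

Coercion hsub_sort : hopfSub >-> Sortclass.

Record hopfHom (k : fieldType) (H K : hopfAlgType k) := HopfHom {
  hopf_hom :> {lrmorphism H -> K};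
  hopf_hom_comul : forall x : H,
    comul (hopf_hom x) = tmap hopf_hom hopf_hom (comul x);
  hopf_hom_counit : forall x : H, counit (hopf_hom x) = counit x;
  hopf_hom_antipode : forall x : H,
    antipode (hopf_hom x) = hopf_hom (antipode x)
}.

Definition hsub_inc (k : fieldType) (H : hopfAlgType k) (L : hopfSub H) :
    hopfHom L H :=
  @HopfHom k L H (@hsub_val k H L)
    (fun x => esym (hsub_comulE x)) (fun=> erefl) (fun=> erefl).

(* A coaction is only required to be linear, not multiplicative. *)
Record coaction (k : fieldType) (A : pzAlgType k) (H : hopfAlgType k) :=
  Coaction {
    coact :> {linear A -> A ⊗ H};
    coactA : forall a : A,
      tassoc (tmap coact idfun (coact a)) = tmap idfun comul (coact a);
    coact_counit : forall a : A, tunitr (tmap idfun counit (coact a)) = a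
  }.

Section Factorizations.
Variables (k : fieldType) (A : pzAlgType k) (H : hopfAlgType k).
Variable delta : coaction A H.

Record factorization := Factorization {
  fact_sub : hopfSub H;
  fact_coact : coaction A fact_sub;
  factE : delta =1 tmap idfun (hsub_inc fact_sub) \o fact_coact
}.

Record fact_hom (F G : factorization) := FactHom {
  fact_map :> hopfHom (fact_sub F) (fact_sub G);
  fact_map_coact : fact_coact G =1 tmap idfun fact_map \o fact_coact F;
  fact_map_inc : hsub_inc (fact_sub G) \o fact_map =1 hsub_inc (fact_sub F)
}.

Definition initial_factorization (F : factorization) : Prop :=
  forall G : factorization,
    exists f : fact_hom F G, forall g : fact_hom F G, g =1 f.

(* δ(A) ⊆ A ⊗ L *)
Definition coact_into (L : hopfSub H) : Prop :=
  forall a : A, tens_img predT (hsub_pred L) (delta a).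

Definition smallest_hopfSub (L : hopfSub H) : Prop :=
  coact_into L /\
  forall L' : hopfSub H, coact_into L' ->
    {subset hsub_pred L <= hsub_pred L'}.

End Factorizations.

(* Main.v *)
(* The intersection of all Hopf subalgebras L with delta(A) in A ⊗ L is again
   one of them, because tensor products over a field commute with arbitrary
   intersections of subspaces: writing t as a sum of u_i ⊗ v_i of minimal
   length makes both families independent, so every u_i and v_i is a slice of t
   and lies in every subspace whose tensor product contains t.  A Hopf
   subalgebra L with delta(A) in A ⊗ L carries a unique factorization, and
   morphisms of factorizations are exactly inclusions of Hopf subalgebras,
   whence initial means smallest. *)
Require Import Defs.
From HB Require Import structures.
From mathcomp Require Import all_boot all_order all_algebra.
From mathcomp Require Import boolp.

Set Implicit Arguments.
Unset Strict Implicit.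
Unset Printing Implicit Defensive.

Import GRing.Theory.
Local Open Scope ring_scope.

(** * Shortest tensor representations and slices *)

Section MinimalRank.
Variables (k : fieldType).

Lemma bilinear_sum_shorten (U V W : lmodType k) (f : {bilinear U -> V -> W})
    n (u : 'I_n.+1 -> U) (v : 'I_n.+1 -> V) (c : 'I_n.+1 -> k) i0 :
  c i0 != 0 -> \sum_i c i *: v i = 0 ->
  exists u' v', \sum_i f (u i) (v i) = \sum_(i < n) f (u' i) (v' i).
Proof.
move=> c0 cv.
(* Solving the relation for [v i0] and substituting it distributes the term of index [i0] over the
   remaining ones, which changes only their left factors. *)
exists (fun i => u (lift i0 i) - (c (lift i0 i) / c i0) *: u i0).
exists (fun i => v (lift i0 i)).
have vi0 : v i0 = - \sum_(i < n) (c (lift i0 i) / c i0) *: v (lift i0 i).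
  move: cv; rewrite (bigD1_ord i0) //= => /eqP; rewrite addr_eq0 => /eqP cv.
  rewrite -[LHS]scale1r -(mulVf c0) -scalerA cv scalerN scaler_sumr.
  by congr (- _); apply: eq_bigr => i _; rewrite scalerA mulrC.
rewrite (bigD1_ord i0) //= vi0 linearN /= linear_sumr /= -sumrN -big_split /=.
apply: eq_bigr => i _.
by rewrite linearBl /= linearZl_LR /= linearZr_LR /= addrC.
Qed.

Definition row_comb (V : lmodType k) n (v : 'I_n -> V) (c : 'rV[k]_n) : V :=
  \sum_i c 0 i *: v i.

Lemma row_comb_linear (V : lmodType k) n (v : 'I_n -> V) :
  linear (row_comb v).
Proof.
move=> a x y; rewrite /row_comb scaler_sumr -big_split /=.
by apply: eq_bigr => i _; rewrite !mxE scalerDl scalerA.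
Qed.

HB.instance Definition _ (V : lmodType k) n (v : 'I_n -> V) :=
  GRing.isLinear.Build k 'rV[k]_n V *:%R (@row_comb V n v) (row_comb_linear v).

(** Independence makes [row_comb v] injective, so it has a linear retraction; the coordinates of
    that retraction are the dual functionals, defined on all of [V] without choosing a basis. *)
Lemma dual_family (V : lmodType k) n (v : 'I_n -> V) :
  (forall c : 'I_n -> k, \sum_i c i *: v i = 0 -> forall i, c i = 0) ->
  exists phi : 'I_n -> {linear V -> k^o}, forall i j, phi i (v j) = (i == j)%:R.
Proof.
move=> free_v; have comb_inj : injective (row_comb v).
  move=> x y /eqP; rewrite -subr_eq0 -linearB => /eqP/free_v xy.
  by apply/rowP => i; apply/eqP; rewrite -subr_eq0 -(xy i) !mxE.
have [g gK] := linear_retraction comb_inj.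
have coord_lin i : linear (fun x => g x 0 i : k^o).
  by move=> a x y; rewrite linearP !mxE.
pose coord i : {linear V -> k^o} := HB.pack (fun x => g x 0 i : k^o)
  (GRing.isLinear.Build k V k^o *:%R _ (coord_lin i)).
exists coord => i j /=.
have -> : v j = row_comb v (delta_mx 0 j).
  rewrite /row_comb (bigD1 j) //= big1 => [|l lj]; rewrite mxE eqxx /=.
    by rewrite eqxx scale1r addr0.
  by rewrite (negPf lj) scale0r.
by rewrite gK mxE eqxx.
Qed.

Variables (U V : lmodType k).

Definition slicel (phi : {linear V -> k^o}) : {linear U ⊗ V -> U} :=
  tunitr \o tmap idfun phi.
Definition slicer (psi : {linear U -> k^o}) : {linear U ⊗ V -> V} :=
  tunitl \o tmap psi idfun.

Lemma slicelE phi u v : slicel phi (u \ox v) = phi v *: u.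
Proof. by rewrite /slicel /= tmapE tunitrE. Qed.

Lemma slicerE psi u v : slicer psi (u \ox v) = psi u *: v.
Proof. by rewrite /slicer /= tmapE tunitlE. Qed.

(** With the arguments swapped, [bilinear_sum_shorten] also exploits a dependence among the left
    factors. *)
Definition tens_rev (v : V) (u : U) := u \ox v.

Lemma tens_rev_bilinear : bilinear_for *:%R *:%R tens_rev.
Proof. by split=> w a x y; rewrite /tens_rev ?tensPl ?tensPr. Qed.

HB.instance Definition _ := bilinear_isBilinear.Build k V U (U ⊗ V)
  *:%R *:%R tens_rev tens_rev_bilinear.

Lemma tens_by_slices (t : U ⊗ V) :
  exists n (u : 'I_n -> U) (v : 'I_n -> V),
    t = \sum_i u i \ox v i /\
    forall i, (exists phi, u i = slicel phi t) /\
              (exists psi, v i = slicer psi t).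
Proof.
pose rep n := exists (u : 'I_n -> U) (v : 'I_n -> V), t = \sum_i u i \ox v i.
have ex_rep : exists n, `[< rep n >].
  have [s tE] := tens_sum t; exists (size s); apply/asboolP.
  exists (fun i => (tnth (in_tuple s) i).1), (fun i => (tnth (in_tuple s) i).2).
  by rewrite tE big_tnth.
case: (ex_minnP ex_rep) => n /asboolP[u [v tE]] min_n; exists n, u, v.
have not_shorter m : n = m.+1 -> ~ rep m.
  by move=> nE /asboolP/min_n; rewrite nE ltnn.
have free_v c : \sum_i c i *: v i = 0 -> forall i, c i = 0.
  move=> cv i; apply/eqP/negP => /negP ci.
  (* The types of [u] and [v] depend on [n], so all are generalized before the split. For [n = 0]
     there is no index [i]; otherwise a nonzero coefficient gives a representation of length [m]. *)
  case: n u v tE {min_n} not_shorter c cv i ci => [|m] u v tE ns c cv i ci.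
    by case: i ci.
  apply: (ns m) => //.
  have [u' [v' e]] := bilinear_sum_shorten (@tens k U V) u ci cv.
  by exists u', v'; rewrite tE.
have free_u c : \sum_i c i *: u i = 0 -> forall i, c i = 0.
  move=> cu i; apply/eqP/negP => /negP ci.
  case: n u v tE {min_n free_v} not_shorter c cu i ci
    => [|m] u v tE ns c cu i ci; first by case: i ci.
  apply: (ns m) => //.
  have [v' [u' e]] := bilinear_sum_shorten tens_rev v ci cu.
  by exists u', v'; rewrite tE.
have [phi phiE] := dual_family free_v; have [psi psiE] := dual_family free_u.
split=> // i; split.
  (* The functional dual to [v i] kills every term of [t] but the one of index [i], leaving
     [u i]. *)
  exists (phi i); rewrite tE linear_sum (bigD1 i) // big1 => [|j ji].
    by rewrite slicelE phiE eqxx scale1r /= addr0.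
  by rewrite slicelE phiE eq_sym (negPf ji) scale0r.
exists (psi i); rewrite tE linear_sum (bigD1 i) // big1 => [|j ji].
  by rewrite slicerE psiE eqxx scale1r /= addr0.
by rewrite slicerE psiE eq_sym (negPf ji) scale0r.
Qed.

Lemma submod_closed_sum (W : lmodType k) (P : {pred W}) I (r : seq I)
    (Q : pred I) (c : I -> k) (w : I -> W) :
  submod_closed P -> (forall i, Q i -> w i \in P) ->
  \sum_(i <- r | Q i) c i *: w i \in P.
Proof.
move=> [P0 Plin] wP; elim/big_rec: _ => // i x Qi xP.
exact: Plin (wP i Qi) xP.
Qed.

Lemma tens_img_slicel (P : {pred U}) (Q : {pred V}) t phi :
  submod_closed P -> tens_img P Q t -> slicel phi t \in P.
Proof.
move=> Pc [s sPQ ->]; rewrite linear_sum big_seq.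
rewrite (eq_bigr (fun p => phi p.2 *: p.1)) => [|p _]; last exact: slicelE.
by apply: submod_closed_sum => // p /sPQ[].
Qed.

Lemma tens_img_slicer (P : {pred U}) (Q : {pred V}) t psi :
  submod_closed Q -> tens_img P Q t -> slicer psi t \in Q.
Proof.
move=> Qc [s sPQ ->]; rewrite linear_sum big_seq.
rewrite (eq_bigr (fun p => psi p.1 *: p.2)) => [|p _]; last exact: slicerE.
by apply: submod_closed_sum => // p /sPQ[].
Qed.

(** A representation by slices depends on [t] alone, so one and the same representation serves all
    indices at once. *)
Lemma tens_img_bigcap I (P : I -> {pred U}) (Q : I -> {pred V}) t :
  (forall i, submod_closed (P i)) -> (forall i, submod_closed (Q i)) ->
  (forall i, tens_img (P i) (Q i) t) ->
  tens_img (fun x => `[< forall i, x \in P i >])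
           (fun x => `[< forall i, x \in Q i >]) t.
Proof.
move=> Pc Qc tPQ; have [n [u [v [tE uv]]]] := tens_by_slices t.
exists [seq (u i, v i) | i <- enum 'I_n]; last by rewrite big_map big_enum.
move=> _ /mapP[i _ ->] /=; have [[phi ->] [psi ->]] := uv i.
split; apply/asboolP => j; first exact: tens_img_slicel (Pc j) (tPQ j).
exact: tens_img_slicer (Qc j) (tPQ j).
Qed.

End MinimalRank.

Lemma tmap_idl_inj (k : fieldType) (U V V' : lmodType k)
    (g : {linear V -> V'}) :
  injective g -> injective (tmap (@idfun U) g).
Proof. by move=> g_inj; apply: tmap_inj. Qed.

(** * Intersections of Hopf subalgebras *)

Section BigCap.
Variables (k : fieldType) (H : hopfAlgType k) (I : Type) (L : I -> hopfSub H).

Lemma hsub_submod_closed (M : hopfSub H) : submod_closed (hsub_pred M).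
Proof.
(* Closure provides [1] but not [0], which is recovered as [(-1) *: 1 + 1]. *)
by have [M1 Mlin _] := hsub_alg M; split=> //; rewrite -[0](addNr 1) -scaleN1r;
  exact: Mlin.
Qed.

Definition hsub_bigcap_pred : {pred H} :=
  fun x => `[< forall i, x \in hsub_pred (L i) >].

Lemma hsub_bigcap_alg : subalg_closed hsub_bigcap_pred.
Proof.
split=> [|a x y /asboolP xL /asboolP yL|x y /asboolP xL /asboolP yL];
  apply/asboolP => i; have [L1 Llin Lmul] := hsub_alg (L i); first exact: L1.
- exact: Llin (xL i) (yL i).
- exact: Lmul (xL i) (yL i).
Qed.

Lemma hsub_bigcap_coalg x : x \in hsub_bigcap_pred ->
  tens_img hsub_bigcap_pred hsub_bigcap_pred (comul x).
Proof.
move=> /asboolP xL; apply: tens_img_bigcap => i; first exact: hsub_submod_closed.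
  exact: hsub_submod_closed.
exact: hsub_coalg.
Qed.

Lemma hsub_bigcap_antipode x :
  x \in hsub_bigcap_pred -> antipode x \in hsub_bigcap_pred.
Proof. by move=> /asboolP xL; apply/asboolP => i; exact: hsub_antipode. Qed.

Definition hsub_bigcap : hopfSub H :=
  HopfSub hsub_bigcap_alg hsub_bigcap_coalg hsub_bigcap_antipode.

End BigCap.

(** * Inclusions as Hopf algebra morphisms *)

Section Inclusion.
Variables (k : fieldType) (H : hopfAlgType k) (L M : hopfSub H).
Hypothesis LM : {subset hsub_pred L <= hsub_pred M}.

Definition hsub_incl_fun (x : L) : M := HSubElt (LM (valP x)).

Lemma hsub_incl_linear : linear hsub_incl_fun.
Proof. by move=> a x y; exact: hsub_val_inj. Qed.

Lemma hsub_incl_monoid_morphism : monoid_morphism hsub_incl_fun.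
Proof. by split=> [|x y]; exact: hsub_val_inj. Qed.

HB.instance Definition _ := GRing.isLinear.Build k L M *:%R
  hsub_incl_fun hsub_incl_linear.
HB.instance Definition _ := GRing.isMonoidMorphism.Build L M
  hsub_incl_fun hsub_incl_monoid_morphism.

(** In [H ⊗ H], where [M ⊗ M] embeds, both sides become the coproduct of [H] at the same element. *)
Lemma hsub_incl_comul x :
  comul (hsub_incl_fun x) = tmap hsub_incl_fun hsub_incl_fun (comul x).
Proof.
pose i2 : {linear M ⊗ M -> H ⊗ H} :=
  tmap (@hsub_val k H M) (@hsub_val k H M).
have i2_inj : injective i2 by apply: tmap_inj; exact: hsub_val_inj.
apply: i2_inj.
rewrite hsub_comulE tmap_comp -[comul (hsub_val _)]/(comul (hsub_val x)).
by rewrite -hsub_comulE; exact: tmap_eq.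
Qed.

Lemma hsub_incl_antipode x :
  antipode (hsub_incl_fun x) = hsub_incl_fun (antipode x).
Proof. exact: hsub_val_inj. Qed.

Definition hsub_incl : hopfHom L M :=
  @HopfHom k L M hsub_incl_fun hsub_incl_comul (fun=> erefl) hsub_incl_antipode.

End Inclusion.

(** * Corestriction of the coaction to a Hopf subalgebra *)

Section Corestriction.
Variables (k : fieldType) (A : pzAlgType k) (H : hopfAlgType k).
Variables (delta : coaction A H) (L : hopfSub H).

Let iA : {linear A ⊗ L -> A ⊗ H} := tmap idfun (@hsub_val k H L).

Let iA_inj : injective iA.
Proof. exact: tmap_idl_inj (@hsub_val_inj _ _ _). Qed.

Lemma factor_coact_into (dL : coaction A L) :
  delta =1 tmap idfun (hsub_inc L) \o dL -> coact_into delta L.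
Proof.
move=> E a; rewrite E /=; have [s ->] := tens_sum (dL a).
exists [seq (p.1, hsub_val p.2) | p <- s].
  by move=> _ /mapP[p _ ->]; split=> //; exact: valP.
by rewrite linear_sum big_map; apply: eq_bigr => p _; rewrite /= tmapE.
Qed.

Hypothesis into : coact_into delta L.

Lemma corestr_subproof a : exists t, iA t = delta a.
Proof.
have [s sL ->] := into a.
(* The default [0] is never reached, since every [p.2] lies in [L]. *)
exists (\sum_(p <- s) p.1 \ox insubd (0 : L) p.2).
rewrite linear_sum; apply: eq_big_seq => p /sL[_ p2] /=.
by rewrite tmapE; congr (_ \ox _); exact: insubdK.
Qed.

Definition corestr_fun (a : A) : A ⊗ L := sval (cid (corestr_subproof a)).

Lemma corestrE a : iA (corestr_fun a) = delta a.
Proof. by rewrite /corestr_fun; case: cid. Qed.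

Lemma corestr_linear : linear corestr_fun.
Proof. by move=> a x y; apply: iA_inj; rewrite linearP !corestrE linearP. Qed.

HB.instance Definition _ := GRing.isLinear.Build k A (A ⊗ L) *:%R
  corestr_fun corestr_linear.

(** Coassociativity is tested in [A ⊗ (H ⊗ H)], into which [A ⊗ (L ⊗ L)] embeds; there it is the
    coassociativity of [delta]. *)
Lemma corestrA a :
  tassoc (tmap corestr_fun idfun (corestr_fun a)) =
  tmap idfun comul (corestr_fun a).
Proof.
pose i2 : {linear L ⊗ L -> H ⊗ H} :=
  tmap (@hsub_val k H L) (@hsub_val k H L).
have i2_inj : injective i2 by apply: tmap_inj; exact: hsub_val_inj.
pose i3 : {linear A ⊗ (L ⊗ L) -> A ⊗ (H ⊗ H)} := tmap idfun i2.
have i3_inj : injective i3 by exact: tmap_idl_inj.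
apply: i3_inj.
(* Naturality of the associator with respect to the inclusion of [L]. *)
have -> : i3 (tassoc (tmap corestr_fun idfun (corestr_fun a))) =
    tassoc (tmap iA (@hsub_val k H L)
      (tmap corestr_fun idfun (corestr_fun a))).
  pose lhs : {linear _ -> _} := i3 \o tassoc.
  pose rhs : {linear _ -> _} := tassoc \o tmap iA (@hsub_val k H L).
  apply: (tens_ext3 (f := lhs) (g := rhs)) => u v w.
  by rewrite /lhs /rhs /i3 /iA /i2 /= !(tmapE, tassocE).
rewrite /i3 !tmap_comp.
have -> : tmap (iA \o corestr_fun) (@hsub_val k H L \o idfun) (corestr_fun a) =
    tmap delta idfun (iA (corestr_fun a)).
  by rewrite tmap_comp; apply: tmap_eq => // y; exact: corestrE.
rewrite corestrE coactA -corestrE tmap_comp.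
by apply: tmap_eq => // y; rewrite /= hsub_comulE.
Qed.

Lemma corestr_counit a : tunitr (tmap idfun counit (corestr_fun a)) = a.
Proof.
by rewrite -[RHS](coact_counit delta) -corestrE tmap_comp; congr (tunitr _).
Qed.

Definition corestr : coaction A L := Coaction corestrA corestr_counit.

Lemma corestr_factor : delta =1 tmap idfun (hsub_inc L) \o corestr.
Proof. by move=> a; rewrite -corestrE. Qed.

End Corestriction.

(** * Initial factorizations and smallest Hopf subalgebras *)

Section Initial.
Variables (k : fieldType) (A : pzAlgType k) (H : hopfAlgType k).
Variable delta : coaction A H.

(** The composite with the injective inclusion into [H] is prescribed, so the category of
    factorizations is a preorder. *)
Lemma fact_hom_uniq (F G : factorization delta) (f g : fact_hom F G) : f =1 g.
Proof.
move=> x; apply: hsub_val_inj.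
by have := fact_map_inc f x; rewrite -(fact_map_inc g x) /=.
Qed.

Lemma fact_hom_subset (F G : factorization delta) :
  fact_hom F G ->
  {subset hsub_pred (fact_sub F) <= hsub_pred (fact_sub G)}.
Proof.
move=> f x xF; rewrite -[x]/(hsub_val (HSubElt xF)).
by rewrite -[hsub_val _](fact_map_inc f); exact: valP.
Qed.

(** Compatibility with the coactions may be checked in [A ⊗ H], by injectivity, and there both sides
    are [delta]. *)
Lemma subset_fact_hom (F G : factorization delta) :
  {subset hsub_pred (fact_sub F) <= hsub_pred (fact_sub G)} -> fact_hom F G.
Proof.
move=> FG; apply: (@FactHom _ _ _ _ _ _ (hsub_incl FG)) => // a.
apply: (tmap_idl_inj (@hsub_val_inj _ _ _)).
have /= <- := Defs.factE G a; rewrite /= tmap_comp (Defs.factE F) /=.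
exact: tmap_eq.
Qed.

(** Initiality is tested against the corestriction of [delta] to each competitor [M]. Conversely,
    each factorization [G] makes [fact_sub G] a competitor, and minimality supplies the
    inclusion. *)
Lemma initial_smallestP (L : hopfSub H) (dL : coaction A L)
    (E : delta =1 tmap idfun (hsub_inc L) \o dL) :
  initial_factorization (Factorization E) <-> smallest_hopfSub delta L.
Proof.
split=> [init|[_ minL] G].
  split=> [|M Minto]; first exact: factor_coact_into E.
  have [f _] := init (Factorization (corestr_factor Minto)).
  exact: (fact_hom_subset f).
have LG : {subset hsub_pred L <= hsub_pred (fact_sub G)}.
  exact/minL/(factor_coact_into (Defs.factE G)).
exists (@subset_fact_hom (Factorization E) G LG) => g; exact: fact_hom_uniq.
Qed.

Lemma smallest_hopfSub_exists : exists L, smallest_hopfSub delta L.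
Proof.
pose L := hsub_bigcap (fun M : {M : hopfSub H | coact_into delta M} => sval M).
exists L; split=> [a|M Minto x /asboolP/(_ (exist _ M Minto))//].
(* The family on the side of [A] is constantly everything, so only the right factors are cut down to
   the intersection. *)
have := @tens_img_bigcap _ _ _ {M : hopfSub H | coact_into delta M}
  (fun=> predT) (fun M => hsub_pred (sval M)) (delta a).
case=> [//|M|[M Minto]|s sPQ ->]; first exact: hsub_submod_closed.
  exact: Minto.
by exists s => // p /sPQ[].
Qed.

End Initial.

Theorem theorem3p3 (k : fieldType) (H : hopfAlgType k)
    (bij_antipode : bijective (antipode : H -> H))
    (A : pzAlgType k) (delta : coaction A H) :
  (exists (Hdelta : hopfSub H) (delta_im : coaction A Hdelta)
      (E : delta =1 tmap idfun (hsub_inc Hdelta) \o delta_im),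
    initial_factorization (Factorization E) /\ smallest_hopfSub delta Hdelta)
  /\
  (forall L : hopfSub H,
    (exists (delta_L : coaction A L)
        (E : delta =1 tmap idfun (hsub_inc L) \o delta_L),
      initial_factorization (Factorization E))
    <-> smallest_hopfSub delta L).
Proof.
split=> [|L].
  have [L smallL] := smallest_hopfSub_exists delta.
  exists L, (corestr smallL.1), (corestr_factor smallL.1).
  by split=> //; apply/initial_smallestP.
split=> [[dL [E /initial_smallestP]]//|smallL].
exists (corestr smallL.1), (corestr_factor smallL.1).
exact/initial_smallestP.
Qed.
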